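(* There is no deterministic online algorithm for the online firefighting game on tadpole graphs that is $f(n)$-competitive for some function $f(n) = o(\sqrt{n})$, where $n$ is the number of vertices of the input graph. Equivalently, every deterministic online algorithm has competitive ratio $\Omega(\sqrt{n})$ on instances whose graph is a tadpole graph.
   Context: Online firefighting game: an instance is $\mathcal{I} = (G, r, (f_i)_{i\ge 1})$, where $G$ is a finite undirected graph with $n$ vertices, $r \in V(G)$ is the fire source, and $f_i \ge 0$ are integers. The graph $G$ and $r$ are known to the algorithm in advance; the number $f_i$ of firefighters is revealed only at the beginning of round $i$. Initially only $r$ is burning. In round $i$, after learning $f_i$, the algorithm assigns at most $f_i$ firefighters to vertices that are neither burning nor already protected (a protected vertex never burns); then the fire spreads from every burning vertex to all of its unprotected neighbours, ending the round. A vertex is saved if it never burns (equivalently, every path from it to $r$ contains a protected vertex). $\mathrm{ALG}(\mathcal{I})$ denotes the number of vertices saved by algorithm ALG, and $\mathrm{OPT}(\mathcal{I})$ the maximum number of vertices that can be saved by any strategy knowing the whole sequence $(f_i)$ in advance. A deterministic online algorithm makes its round-$i$ decisions as a deterministic function of $G, r, f_1,\dots,f_i$ and its previous decisions. An algorithm is $c$-competitive (where $c$ may depend on $n$) on a graph class if $\mathrm{OPT}(\mathcal{I})/\mathrm{ALG}(\mathcal{I}) \le c$ for every instance $\mathcal{I}$ whose graph is in the class and has $n$ vertices. A tadpole graph is the graph obtained from a simple cycle and a simple path by identifying one vertex of the cycle with an endpoint of the path. *)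

(* Defs.v *)
From mathcomp Require Import all_boot all_order all_algebra.
From mathcomp Require Import all_classical all_reals all_analysis.

Set Implicit Arguments.
Unset Strict Implicit.
Unset Printing Implicit Defensive.

Import Order.TTheory GRing.Theory Num.Theory.
Import numFieldNormedType.Exports.

Local Open Scope ring_scope.

Record sgraph := SGraph {
  vertex :> finType;
  edge : rel vertex;
  edge_sym : symmetric edge;
  edge_irr : irreflexive edge
}.

Definition consecutive (T : eqType) (s : seq T) (x y : T) : bool :=
  infix [:: x; y] s || infix [:: y; x] s.

(** The cycle is the closed walk [v, c, v] and the path is [v :: p]; they share
    exactly the vertex [v].  A cycle has at least three vertices and the path
    has at least one edge. *)
Definition tadpole (G : sgraph) : Prop :=
  exists (v : G) (c p : seq G),
    [/\ (2 <= size c)%N, (1 <= size p)%N,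
        uniq (v :: c ++ p),
        (forall x : G, x \in v :: c ++ p) &
        forall x y : G, edge x y =
          consecutive (v :: rcons c v) x y || consecutive (v :: p) x y].

(** Rounds are numbered from [0], so [firefighters I i] is the usual
    $f_{i+1}$. *)
Record instance := Instance {
  graph :> sgraph;
  source : graph;
  firefighters : nat -> nat
}.

(** [D i] is the set of vertices protected by the decision of round [i]. *)
Definition strategy (G : sgraph) := nat -> {set G}.

Section Game.
Variables (G : sgraph) (r : G).

(** State at the beginning of round [i]. *)
Definition protected (D : strategy G) (i : nat) : {set G} :=
  \bigcup_(j < i) D j.

Fixpoint burning (D : strategy G) (i : nat) : {set G} :=
  if i is j.+1 then
    burning D j :|:
    [set y : G | (y \notin protected D j.+1) &&
                 [exists x in burning D j, edge x y]]
  else [set r].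

Definition legal (f : nat -> nat) (D : strategy G) : Prop :=
  forall i, (#|D i| <= f i)%N /\
            [disjoint D i & burning D i :|: protected D i].

Definition saved (D : strategy G) : {set G} :=
  [set x : G | `[< forall i, x \notin burning D i >]].

End Game.

Definition OPT (I : instance) : nat :=
  \max_(k < #|vertex I|.+1 |
        `[< exists D : strategy I,
              legal (source I) (firefighters I) D /\
              #|saved (source I) D| = k >]) k.

(** A decision is a function of the graph, the source, the firefighter numbers
    revealed so far (current round included) and the previous decisions. *)
Definition algorithm :=
  forall G : sgraph, G -> seq nat -> seq {set G} -> {set G}.

Section Algorithm.
Variable A : algorithm.

Fixpoint decisions (G : sgraph) (r : G) (f : nat -> nat) (i : nat) :
    seq {set G} :=
  if i is j.+1 then
    let h := decisions r f j in rcons h (A r (mkseq f j.+1) h)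
  else [::].

Definition run (G : sgraph) (r : G) (f : nat -> nat) : strategy G :=
  fun i => A r (mkseq f i.+1) (decisions r f i).

Definition online_algorithm_on (C : sgraph -> Prop) : Prop :=
  forall G : sgraph, C G -> forall (r : G) (f : nat -> nat),
    legal r f (run r f).

Definition ALG (I : instance) : nat :=
  #|saved (source I) (run (source I) (firefighters I))|.

Section Ratio.
Variable R : realType.

(** In [\bar R], [0^-1 = +oo] and [0 * +oo = 0]: the ratio is [+oo] when only
    the algorithm saves nothing, and [0] when nothing can be saved. *)
Definition performance_ratio (I : instance) : \bar R :=
  ((OPT I)%:R%:E / (ALG I)%:R%:E)%E.

Definition competitive_on (C : sgraph -> Prop) (c : nat -> R) : Prop :=
  forall I : instance, C I -> (performance_ratio I <= (c #|vertex I|)%:E)%E.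

Definition competitive_ratio (C : sgraph -> Prop) (n : nat) : \bar R :=
  ereal_sup [set x | exists I : instance,
                     [/\ C I, #|vertex I| = n & performance_ratio I = x]]%classic.

End Ratio.
End Algorithm.

(* Main.v *)
(** The fire starts at the vertex [v] shared by the cycle and the path, where
    the path has about [sqrt n] vertices, and one firefighter is available in
    the first round.  If the algorithm does not place it on the path, no further
    firefighter comes: the algorithm saves at most one vertex, while protecting
    the first vertex of the path saves the whole path.  If it does, exactly one
    more firefighter comes in the second round.  The algorithm saves at most one
    vertex of the cycle, which burns from both sides, whereas protecting one
    neighbour of [v] on the cycle in the first round, and stopping the fire
    behind the other neighbour in the second, saves all but one of the vertices
    of the cycle other than [v].  Both ratios are of order [sqrt n]. *)
Require Import Defs.
From mathcomp Require Import all_boot all_order all_algebra.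
From mathcomp Require Import all_classical all_reals all_analysis.
From mathcomp Require Import zify lra.

Set Implicit Arguments.
Unset Strict Implicit.
Unset Printing Implicit Defensive.

Import Order.TTheory GRing.Theory Num.Theory.
Import numFieldNormedType.Exports.

Lemma consecutiveC (T : eqType) (s : seq T) x y :
  consecutive s x y = consecutive s y x.
Proof. by rewrite /consecutive orbC. Qed.

Lemma consecutive1 (T : eqType) (a x y : T) : consecutive [:: a] x y = false.
Proof. by rewrite /consecutive /= !andbF. Qed.

Lemma consecutive_cons (T : eqType) (a b : T) s x y :
  consecutive [:: a, b & s] x y =
  [|| (x == a) && (y == b), (y == a) && (x == b) | consecutive (b :: s) x y].
Proof.
rewrite /consecutive (infix_consl [:: x; y] a) (infix_consl [:: y; x] a).
by rewrite !prefix_cons !prefix0s !andbT orbACA -orbA.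
Qed.

(** The pivot [m] is kept in both pieces, so no consecutive pair is lost at the cut. *)
Lemma consecutive_cat (T : eqType) s1 (m : T) s2 x y :
  consecutive (s1 ++ m :: s2) x y =
  consecutive (rcons s1 m) x y || consecutive (m :: s2) x y.
Proof.
elim: s1 => [|a [|b s1] IH]; first by rewrite consecutive1.
  by rewrite /= !consecutive_cons consecutive1 orbF -orbA.
by move: IH; rewrite /= !consecutive_cons => ->; rewrite -!orbA.
Qed.

Lemma consecutive_mem (T : eqType) (s : seq T) x y :
  consecutive s x y -> (x \in s) && (y \in s).
Proof.
by case/orP=> /infixP[s1 [s2 ->]]; rewrite !mem_cat !inE !eqxx !orbT.
Qed.

Lemma path_consecutive (T : eqType) (e : rel T) (x : T) s :
  (forall y z, consecutive (x :: s) y z -> e y z) -> path e x s.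
Proof.
elim: s x => //= y s IH x sub_e; rewrite sub_e ?consecutive_cons ?eqxx //=.
by apply: IH => z t zt; apply: sub_e; rewrite consecutive_cons zt !orbT.
Qed.

Lemma consecutive_path (T : eqType) (e : rel T) (x : T) s y z :
  path e x s -> consecutive (x :: s) y z -> e y z || e z y.
Proof.
elim: s x => [|t s IH] x /=; first by rewrite consecutive1.
case/andP=> xt /IH{}IH; rewrite consecutive_cons.
by case/or3P=> [/andP[/eqP-> /eqP->]|/andP[/eqP-> /eqP->]|//]; rewrite xt ?orbT.
Qed.

(** * Tadpoles with prescribed cycle and path lengths *)

(** The body of [tadpole] with its witnesses exposed, so that bounds can mention the lengths of [c]
    and [p]. *)
Definition tadpole_on (G : sgraph) (v : G) (c p : seq G) : Prop :=
  [/\ (2 <= size c)%N, (1 <= size p)%N, uniq (v :: c ++ p),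
      (forall x : G, x \in v :: c ++ p) &
      forall x y : G, edge x y =
        consecutive (v :: rcons c v) x y || consecutive (v :: p) x y].

Lemma card_tadpole (G : sgraph) (v : G) c p :
  tadpole_on v c p -> #|G| = (size c + size p).+1.
Proof.
case=> _ _ vcp_uniq vcp_all _; have := card_uniqP vcp_uniq.
by rewrite /= size_cat => <-; apply: eq_card => x; rewrite vcp_all inE.
Qed.

Lemma tadpole_exists k m : (2 <= k)%N -> (1 <= m)%N ->
  exists (G : sgraph) (v : G) c p,
    [/\ tadpole_on v c p, size c = k & size p = m].
Proof.
move=> k2 m1; pose T := 'I_(k + m).+1.
have := enum_uniq T; have := @mem_enum T T; have := size_enum_ord (k + m).+1.
case: (enum _) => // v s [size_s] all_s uniq_s.
pose c := take k s; pose p := drop k s.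
have size_c : size c = k by rewrite size_takel // size_s leq_addr.
have size_p : size p = m by rewrite size_drop size_s addKn.
have uniq_vcp : uniq (v :: c ++ p) by rewrite cat_take_drop.
pose e (x y : T) := consecutive (v :: rcons c v) x y || consecutive (v :: p) x y.
have e_sym : symmetric e by move=> x y; rewrite /e !(consecutiveC _ x).
have uniq_path (q : seq T) : uniq (v :: q) -> path (fun x y => x != y) v q.
  by rewrite uniq_pairwise => /pairwise_sorted.
have no_loop (q : seq T) x :
    path (fun y z => y != z) v q -> consecutive (v :: q) x x = false.
  by move=> vq; apply/negP=> /(consecutive_path vq); rewrite eqxx.
have [uniq_vc uniq_vp] : uniq (v :: c) /\ uniq (v :: p).
  by move: uniq_vcp; rewrite /= mem_cat cat_uniq negb_or => /and4P[/andP[-> ->] -> _ ->].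
(* A loop could only come from the closing pair of the cycle, and [v] differs from the last vertex
   of [c] since [c] is not empty. *)
have e_irr : irreflexive e.
  move=> x; rewrite /e (no_loop p) ?uniq_path // orbF no_loop // rcons_path uniq_path //=.
  case: (c) size_c uniq_vc => [|a c']; first by move=> /= k0; rewrite -k0 in k2.
  by move=> _ /= /andP[va _]; apply: contraNneq va => <-; apply: mem_last.
exists (SGraph e_sym e_irr), v, c, p; split=> //; split=> //.
- by rewrite size_c.
- by rewrite size_p.
- by move=> x; rewrite cat_take_drop all_s.
Qed.

(** * Bounding the fire from below and from above *)

Lemma notin_savedP (G : sgraph) (r : G) D x :
  reflect (exists i, x \in burning r D i) (x \notin saved r D).
Proof.
rewrite inE; apply: (iffP idP) => [/asboolPn/existsNP[i /negP/negPn]|[i xi]].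
  by exists i.
by apply/asboolPn => /(_ i); rewrite xi.
Qed.

Lemma source_notin_saved (G : sgraph) (r : G) D : r \notin saved r D.
Proof. by apply/notin_savedP; exists 0; rewrite inE. Qed.

(** The fire advances by at least one vertex per round along a path that is never protected. *)
Lemma path_notin_saved (G : sgraph) (r : G) D x q :
  path (@edge G) x q -> x \notin saved r D ->
  (forall y i, y \in q -> y \notin D i) ->
  {in q, forall y, y \notin saved r D}.
Proof.
elim: q x => //= y q IH x /andP[xy yq] /notin_savedP[i xi] free z.
have y_burns : y \notin saved r D.
  apply/notin_savedP; exists i.+1; rewrite /= !inE; apply/orP; right.
  apply/andP; split; last by apply/existsP; exists x; rewrite xi.
  by apply/bigcupP => -[j _]; apply/negP/free; rewrite mem_head.
rewrite inE => /predU1P[-> //|]; apply: IH yq y_burns _ _ => t j tq.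
by apply: free; rewrite inE tq orbT.
Qed.

(** An invariant for confining the fire. The closure condition keeps track of the round [i], so an
    exit from [B] may be blocked late, provided its inner end is not yet burning before. *)
Lemma burning_sub (G : sgraph) (r : G) D (B : {pred G}) :
  r \in B ->
  (forall i x y, x \in B -> x \in burning r D i -> edge x y ->
     y \notin protected D i.+1 -> y \in B) ->
  forall i, {subset burning r D i <= B}.
Proof.
move=> rB closedB; elim=> [|i IH] x /=; first by rewrite inE => /eqP->.
rewrite !inE => /orP[/IH //|/andP[x_free /existsP[y /andP[yi yx]]]].
exact: closedB (IH _ yi) yi yx x_free.
Qed.

Lemma leq_OPT (G : sgraph) (r : G) f D :
  legal r f D -> (#|saved r D| <= OPT (Instance r f))%N.
Proof.
move=> D_legal; have saved_lt : (#|saved r D| < #|G|.+1)%N by rewrite ltnS max_card.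
apply: (@leq_bigmax_cond _ _ (fun k : 'I__ => k : nat) (Ordinal saved_lt)).
by apply/asboolP; exists D.
Qed.

(** * Offline strategies placing one firefighter per round *)

Definition placing (G : sgraph) (s : seq G) : strategy G :=
  fun i => [set x in s | index x s == i].

Lemma in_protected_placing (G : sgraph) (s : seq G) i x :
  (x \in protected (placing s) i) = (x \in s) && (index x s < i)%N.
Proof.
apply/bigcupP/andP=> [[j _]|[xs ltxi]]; last first.
  by exists (Ordinal ltxi); rewrite ?inE ?xs /=.
by rewrite !inE => /andP[-> /eqP->].
Qed.

(** Indices determine elements, so each round protects at most one vertex and never an old one; only
    the fire has to be checked. *)
Lemma legal_placing (G : sgraph) (r : G) (s : seq G) :
  {in s, forall x, x \notin burning r (placing s) (index x s)} ->
  legal r (fun i => (i < size s)%N) (placing s).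
Proof.
move=> s_free i; split.
  have [lt_is|le_si] := ltnP.
    rewrite /= -(cards1 (nth r s i)); apply: subset_leq_card; apply/fintype.subsetP=> x.
    by rewrite !inE => /andP[xs /eqP<-]; rewrite nth_index.
  rewrite leqn0 cards_eq0; apply/eqP/setP=> x; rewrite !inE.
  by apply/andP=> -[]; rewrite -index_mem => + /eqP ix; rewrite ix ltnNge le_si.
apply/pred0P=> x /=; rewrite !inE in_protected_placing.
apply/negP=> /andP[/andP[xs /eqP <-]].
by rewrite ltnn andbF orbF; apply/negP/s_free.
Qed.

(** * A single firefighter on the cycle *)

(** If [x] is outside [S], one of the two arcs from [v] to [x] avoids the at most one vertex of [S],
    and the fire reaches [x] along it. *)
Lemma cycle_saved (G : sgraph) (v : G) c (D : strategy G) (S : {set G}) :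
  uniq (v :: c) -> path (@edge G) v (rcons c v) -> (#|S| <= 1)%N ->
  (forall i x, x \in c -> x \in D i -> x \in S) ->
  forall x, x \in c -> x \in saved v D -> x \in S.
Proof.
rewrite cons_uniq => /andP[_ uniq_c] vcv S1 D_sub x xc x_saved; apply/negPn/negP=> xS.
move: x_saved; apply/negP.
have path_burns q : path (@edge G) v (rcons q x) -> {subset q <= c} ->
    {in q, forall y, y \notin S} -> x \notin saved v D.
  move=> vq qc qS; apply: (path_notin_saved vq (source_notin_saved _ _)).
    move=> y i; rewrite mem_rcons inE => /predU1P[->|yq].
      by apply: contra xS; apply: D_sub.
    by apply: contra (qS y yq); apply: D_sub; apply: qc.
  by rewrite mem_rcons mem_head.
case/splitPr: xc uniq_c vcv D_sub path_burns => c1 c2.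
rewrite cat_uniq => /and3P[_ /hasPn dis _] vcv _ path_burns.
have [/existsP[y /andP[yc1 yS]]|c1S] :=
  boolP [exists y, (y \in c1) && (y \in S)]; last first.
  apply: (path_burns c1).
  - by move: vcv; rewrite rcons_cat /= -cat_rcons cat_path => /andP[].
  - by move=> y yc1; rewrite mem_cat yc1.
  by move=> y yc1; apply: contra c1S => yS; apply/existsP; exists y; rewrite yc1.
(* The vertex of [S] lies on the arc [c1], so the fire takes the other arc, read backwards. *)
apply: (path_burns (rev c2)).
- have: path (@edge G) v (rev (c1 ++ x :: c2) ++ [:: v]).
    have := rev_path (@edge G) v (rcons (c1 ++ x :: c2) v).
    rewrite last_rcons belast_rcons rev_cons -cats1 => ->.
    by under eq_path do rewrite edge_sym.
  by rewrite rev_cat rev_cons -catA cat_path => /andP[].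
- by move=> z; rewrite mem_rev mem_cat inE => ->; rewrite !orbT.
move=> z; rewrite mem_rev => zc2; apply/negP=> zS.
have := card_le1_eqP S1 _ _ yS zS => yz.
by have := dis z; rewrite inE zc2 orbT => /(_ isT); rewrite yz yc1.
Qed.

(** * Lower bounds on the offline optimum *)

Lemma leq_saved (G : sgraph) (r : G) D (B : {pred G}) (s : seq G) :
  uniq s -> (forall i, {subset burning r D i <= B}) ->
  {in s, forall x, x \notin B} -> (size s <= #|saved r D|)%N.
Proof.
move=> uniq_s burnB sB; rewrite -(card_uniqP uniq_s).
apply: subset_leq_card; apply/fintype.subsetP=> x xs; rewrite inE; apply/asboolP=> i.
by apply: contra (sB x xs); apply: burnB.
Qed.

Lemma OPT_path (G : sgraph) (v : G) c p : tadpole_on v c p ->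
  (size p <= OPT (Instance v (fun i => (i < 1)%N)))%N.
Proof.
case=> _; case: p => // b p _ uniq_vcp _ edgeE.
have p_notin x : x \in b :: p -> x \notin v :: c.
  move: uniq_vcp; rewrite -cat_cons cat_uniq => /and3P[_ /hasPn notin _].
  exact: notin.
have bv : b != v by have := p_notin b; rewrite !inE eqxx negb_or => /(_ isT)/andP[].
apply: leq_trans (leq_OPT (D := placing [:: b]) _); last first.
  apply: (@legal_placing _ _ [:: b]) => x; rewrite inE => /eqP->.
  by rewrite /= eqxx inE.
apply: (leq_saved (B := mem (v :: c))) => //.
  by move: uniq_vcp; rewrite -cat_cons cat_uniq => /and3P[].
apply: burning_sub => [|i x y xvc _]; first exact: mem_head.
rewrite edgeE in_protected_placing => /orP[/consecutive_mem/andP[_]|].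
  by rewrite -rcons_cons mem_rcons !inE orbA orbb.
rewrite consecutive_cons => /or3P[/andP[_ /eqP->]|/andP[/eqP-> _] _|].
- by rewrite /= inE eqxx.
- exact: mem_head.
by case/consecutive_mem/andP=> /p_notin; rewrite xvc.
Qed.

(** With the cycle read as [v], [a], ..., [y], [z], protect [a] and then [y]. Only [z] is given up
    on the cycle, whence the successor on the right. *)
Lemma OPT_cycle (G : sgraph) (v : G) c p : tadpole_on v c p ->
  (3 <= size c)%N ->
  (size c <= (OPT (Instance v (fun i => (i < 2)%N))).+1)%N.
Proof.
case=> _ _ uniq_vcp _ edgeE.
case: c uniq_vcp edgeE => // a c; case/lastP: c => // c z; case/lastP: c => // c y.
move=> uniq_vcp edgeE _; rewrite /= !size_rcons ltnS.
pose B := [pred x | x \in [:: v, z & p]].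
have notinB x : x \in a :: rcons c y -> x \notin B.
  move: uniq_vcp; rewrite (_ : v :: _ = [:: v] ++ (a :: rcons c y) ++ z :: p).
    by rewrite uniq_catCA cat_uniq => /and3P[_ /hasPn notin _]; apply: contraL => /notin.
  by rewrite /= cat_rcons.
have uniq_ac : uniq (a :: rcons c y).
  move: uniq_vcp; rewrite cons_uniq -rcons_cons cat_uniq rcons_uniq.
  by case/and4P=> _ /andP[].
(* The only exits from [B] are the edges from [v] to [a] and from [z] to [y]. *)
have edge_out x w : x \in B -> edge x w ->
    [|| w \in B, (x == v) && (w == a) | (x == z) && (w == y)].
  move=> xB; rewrite edgeE => /orP[|/consecutive_mem/andP[_ wp]]; last first.
    by move: wp; rewrite !inE => /orP[->//|->]; rewrite !orbT.
  have -> : v :: rcons (a :: rcons (rcons c y) z) v = [:: v, a & c] ++ [:: y; z; v].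
    by rewrite /= -!cats1 -!catA.
  rewrite consecutive_cat /= !consecutive_cons consecutive1 orbF.
  case/orP=> /or3P[].
  - by move=> ->; rewrite orbT.
  - by case/andP=> /eqP->; rewrite !inE eqxx.
  - by case/consecutive_mem/andP=> /notinB; rewrite xB.
  - by case/andP=> _ /eqP->; rewrite !inE eqxx !orbT.
  - by case/andP=> -> ->; rewrite !orbT.
  by case/orP=> /andP[/eqP-> /eqP->]; rewrite !inE eqxx ?orbT.
have vB : v \in B by rewrite !inE eqxx.
have ya : y != a by apply: contraTneq uniq_ac => ->; rewrite /= mem_rcons mem_head.
have vz : v != z.
  by apply: contraTneq uniq_vcp => ->; rewrite cons_uniq;
    rewrite !(inE, mem_cat, mem_rcons) eqxx !orbT.
pose D := placing [:: a; y].
have burnB : forall i, {subset burning v D i <= B}.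
  apply: burning_sub => // i x w xB xi /(edge_out _ _ xB).
  rewrite in_protected_placing => /or3P[//|/andP[_ /eqP->]|/andP[/eqP xz /eqP->]].
    by rewrite !inE /= eqxx.
  (* In round [0] only [v] burns, so [z] cannot pass the fire on before [y] is protected in round
     [1]. *)
  case: i xi => [|i _]; first by rewrite inE xz eq_sym (negPf vz).
  by rewrite !inE eqxx orbT /= eq_sym (negPf ya) eqxx.
apply: leq_trans (leq_OPT (D := D) _).
  by have := leq_saved uniq_ac burnB notinB; rewrite /= size_rcons.
apply: (@legal_placing _ _ [:: a; y]) => x x_ay.
have xB : x \notin B.
  by move: x_ay; rewrite !inE => /orP[]/eqP->; apply: notinB;
    rewrite !(inE, mem_rcons) eqxx ?orbT.
by apply: contra xB; apply: burnB.
Qed.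

(** * The adversary *)

Lemma run_after_budget A (G : sgraph) (v : G) k :
  legal v (fun i => (i < k)%N) (run A v (fun i => (i < k)%N)) ->
  forall i, (k <= i)%N -> run A v (fun i => (i < k)%N) i = finset.set0.
Proof.
move=> legalA i le_ki; have [+ _] := legalA i.
by rewrite ltnNge le_ki leqn0 cards_eq0 => /eqP.
Qed.

Lemma tadpole_adversary A (G : sgraph) (v : G) c p :
  tadpole_on v c p -> (3 <= size c)%N ->
  (forall f, legal v f (run A v f)) ->
  exists f, let I := Instance v f in
    (ALG A I <= 1 /\ size p <= OPT I)%N \/
    (ALG A I <= (size p).+1 /\ size c <= (OPT I).+1)%N.
Proof.
move=> tad c3 legalA; have [_ _ uniq_vcp all_vcp edgeE] := tad.
pose budget k i : nat := (i < k)%N; pose D k := run A v (budget k).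
have D_late k i : (k <= i)%N -> D k i = finset.set0 by apply/run_after_budget/legalA.
have D_card k i : (#|D k i| <= 1)%N.
  by have [/leq_trans-> //] := legalA (budget k) i; rewrite /budget leq_b1.
(* Both budgets start with [1], so the algorithm cannot tell them apart in round [0]. *)
have D0 : D 1%N 0%N = D 2%N 0%N by [].
have uniq_vc : uniq (v :: c).
  by move: uniq_vcp; rewrite -cat_cons cat_uniq => /and3P[].
have v_cycle : path (@edge G) v (rcons c v).
  by apply: path_consecutive => x y xy; rewrite edgeE xy.
have v_path : path (@edge G) v p.
  by apply: path_consecutive => x y xy; rewrite edgeE xy orbT.
have in_saved k x : x \in saved v (D k) -> (x \in c) || (x \in p).
  move=> x_saved; have := all_vcp x; rewrite inE mem_cat => /predU1P[xv|//].
  by rewrite xv (negPf (source_notin_saved _ _)) in x_saved.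
have [/existsP[t /andP[tp tD]]|p_free] :=
  boolP [exists t, (t \in p) && (t \in D 1%N 0%N)].
  exists (budget 2); right; split; last exact: OPT_cycle tad c3.
  have : saved v (D 2) \subset [set x in p] :|: D 2%N 1%N.
    apply/fintype.subsetP=> x x_saved; rewrite !inE.
    have := in_saved _ _ x_saved; rewrite orbC => /orP[-> //|xc].
    apply/orP; right; apply: cycle_saved uniq_vc v_cycle (D_card _ _) _ x xc x_saved.
    (* The only firefighter of round [0] stands at [t] on the path, so the cycle receives at most
       that of round [1]. *)
    move=> [|[|i]] y yc //; last by rewrite D_late ?finset.inE.
    rewrite -D0 => yD; have yt := card_le1_eqP (D_card _ _) _ _ tD yD.
    move: uniq_vcp; rewrite cons_uniq cat_uniq => /and4P[_ _ /hasPn/(_ _ tp) + _].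
    by rewrite /= -yt yc.
  move=> /subset_leq_card/leq_trans; apply; apply: leq_trans (leq_card_setU _ _) _.
  by rewrite -[(size p).+1]addn1 leq_add // cardsE card_size.
exists (budget 1); left; split; last exact: OPT_path tad.
suff: saved v (D 1%N) \subset D 1%N 0%N by move/subset_leq_card/leq_trans; apply.
apply/fintype.subsetP=> x x_saved; case/orP: (in_saved _ _ x_saved) => [xc|xp].
  apply: cycle_saved uniq_vc v_cycle (D_card _ _) _ x xc x_saved.
  by move=> [|i] y yc //; rewrite D_late ?finset.inE.
have p_unprotected y i : y \in p -> y \notin D 1%N i.
  case: i => [|i] yp; last by rewrite D_late ?finset.inE.
  by apply: contra p_free => yD; apply/existsP; exists y; rewrite yp.
have := path_notin_saved v_path (source_notin_saved _ _) p_unprotected xp.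
by rewrite x_saved.
Qed.

Local Open Scope ring_scope.
Local Open Scope classical_set_scope.

(** * From vertex counts to ratios *)

(** Positivity of [OPT I] makes the ratio [+oo], not [0], when the algorithm saves nothing. *)
Lemma ratio_ge (R : realType) A (I : instance) (x : R) :
  (0 < OPT I)%N -> x * (ALG A I)%:R <= (OPT I)%:R ->
  (x%:E <= performance_ratio A R I)%E.
Proof.
move=> OPT_gt0; rewrite /performance_ratio inver pnatr_eq0.
have [->|ALG_neq0] := eqVneq (ALG A I) 0%N.
  by rewrite gt0_muley ?leey // lte_fin ltr0n.
by rewrite -EFinM lee_fin ler_pdivlMr // ltr0n lt0n.
Qed.

Lemma tadpole_ratio (R : realType) A n :
  online_algorithm_on A tadpole -> (9 <= n)%N ->
  exists I : instance, [/\ tadpole I, #|vertex I| = n &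
    ((4^-1 * Num.sqrt n%:R)%:E <= performance_ratio A R I)%E].
Proof.
(* [m] is the integer square root of [n]; it becomes the length of [p]. *)
move=> legalA n9; have [m le_m2 lt_nm2] : exists2 m, (m * m <= n)%N & (n < m.+1 * m.+1)%N.
  have ex : exists m, (m * m <= n)%N by exists 0%N.
  have bnd m : (m * m <= n)%N -> (m <= n)%N by nia.
  have [m m2 max_m] := ex_maxnP ex bnd; exists m => //.
  by rewrite ltnNge; apply/negP=> /max_m; rewrite ltnn.
have m3 : (3 <= m)%N by nia.
have [||G [v [c [p [tad size_c size_p]]]]] := @tadpole_exists (n - m.+1) m.
- by nia.
- by nia.
have tadG : tadpole G by exists v, c, p.
have [|f] := tadpole_adversary (A := A) tad _ (fun f => legalA G tadG v f).
  by rewrite size_c; nia.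
set I := Instance v f; rewrite /= size_c size_p => bounds.
have sqrt_n : Num.sqrt n%:R <= m.+1%:R :> R.
  rewrite -[leRHS]ger0_norm // -sqrtr_sqr ler_wsqrtr // -natrX ler_nat.
  by rewrite -mulnn ltnW.
(* If the cycle is lost, [OPT I] is at least [m * m - m - 2 = (m + 1) * (m - 2)], and
   [m + 1 <= 4 * (m - 2)] exactly when [3 <= m]: hence the factor [4] and the threshold [9]. *)
have OPT_ge : ((ALG A I) * m.+1 <= 4 * OPT I)%N /\ (0 < OPT I)%N.
  by case: bounds => -[ub lb]; split; nia.
exists I; split=> //; first by rewrite (card_tadpole tad) size_c size_p; nia.
case: OPT_ge => OPT_ge /ratio_ge; apply.
move: OPT_ge; rewrite -(ler_nat R) !natrM => OPT_ge.
have := ler_wpM2l (ler0n R (ALG A I)) sqrt_n; lra.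
Qed.

Theorem theorem1 (R : realType) (A : algorithm) :
  online_algorithm_on A tadpole ->
  (forall f : nat -> R,
     f =o_\oo (fun n : nat => Num.sqrt (n%:R : R)) ->
     ~ competitive_on A tadpole f) /\
  (exists2 c : R, 0 < c &
     \forall n \near \oo,
       ((c * Num.sqrt n%:R)%:E <= competitive_ratio A R tadpole n)%E).
Proof.
move=> legalA; split=> [f /eqoP f_o compA|].
  (* Any constant below [4^-1] contradicts the lower bound of [tadpole_ratio] at a large [n]. *)
  have eps_gt0 : 0 < 8^-1 :> R by lra.
  have [N _ f_small] := f_o _ eps_gt0; pose n := maxn 9 N.
  have [I [tadI card_I ratio_I]] := tadpole_ratio R legalA (leq_maxl 9 N).
  have := le_trans ratio_I (compA I tadI); rewrite card_I lee_fin => f_ge.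
  have := f_small n (leq_maxr 9 N); rewrite /= [`|Num.sqrt _|]ger0_norm ?sqrtr_ge0 //.
  have : 0 < Num.sqrt n%:R :> R.
    by rewrite sqrtr_gt0 ltr0n; apply: leq_trans (leq_maxl 9 N).
  have := ler_norm (f n); rewrite -/n in f_ge; lra.
exists 4^-1; first by lra.
exists 9%N => // n /= n9; have [I [tadI card_I ratio_I]] := tadpole_ratio R legalA n9.
by apply: le_trans ratio_I _; apply: ereal_sup_ubound; exists I.
Qed.
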